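(* Let $n\ge 2$ be an integer and let $B_n$ be the complete binary tree of height $n$. Then \[ \psi(B_n)=(2^{n-1}-1)+\sum_{i=0}^{\lfloor\frac{n-1}{3}\rfloor}\left(2^{3i+1}+\sum_{j=1}^{n-3i-2}2^{j-1}2^{3i+2j+1}\right)+\sum_{k=1}^{\lfloor\frac{n+1}{3}\rfloor}2^{n-3k+1}2^{2n-3k+2}+\gamma_n, \] where $\gamma_n=2^{n-1}$ if $n\equiv 0\pmod 3$, and $\gamma_n=0$ otherwise.
   Context: The complete binary tree $B_n$ of height $n$ is the rooted tree with $2^i$ vertices at distance $i$ from the root for $0\le i\le n$, in which each vertex has exactly two children, except for the $2^n$ vertices at distance $n$ from the root, which have no children. A sum whose upper limit is smaller than its lower limit is empty and equals $0$. All graphs are finite, simple and connected. A configuration of pebbles on a graph $G$ is a function $C:V(G)\to\mathbb{N}\cup\{0\}$, where $C(v)$ is the number of (indistinguishable) pebbles on $v$; its number of pebbles is $\sum_{v\in V(G)} C(v)$. A pebbling move removes two pebbles from some vertex $u$ having at least two pebbles and places one pebble on a vertex adjacent to $u$ (the other pebble is discarded). A set $D\subseteq V(G)$ is a dominating set if every vertex of $G$ is in $D$ or adjacent to an element of $D$. The domination cover pebbling number $\psi(G)$ is the minimum number of pebbles such that every initial configuration with that number of pebbles on $V(G)$ can be transformed, by some (possibly empty) finite sequence of pebbling moves, into a configuration in which the set of vertices containing at least one pebble is a dominating set of $G$ (the dominating set may depend on the initial configuration and need not be a minimum dominating set). *)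

(* Defs.v *)
From mathcomp Require Import all_boot.
Set Implicit Arguments.
Unset Strict Implicit.
Unset Printing Implicit Defensive.

Record graph := Graph {
  vertex :> finType;
  adj : rel vertex;
  adj_sym : symmetric adj;
  adj_irrefl : irreflexive adj;
  adj_connected : forall u v, connect adj u v
}.

Section Pebbling.
Variable G : graph.

Definition config := {ffun G -> nat}.

Definition num_pebbles (C : config) : nat := \sum_(v : G) C v.

Definition move (C : config) (u v : G) : config :=
  [ffun x => if x == u then C x - 2 else if x == v then C x + 1 else C x].

Definition pebbling_move : rel config := fun C C' =>
  [exists u : G, exists v : G, [&& adj u v, 2 <= C u & C' == move C u v]].

Definition dominating (D : {set G}) : bool :=
  [forall v : G, (v \in D) || [exists u in D, adj u v]].

Definition occupied (C : config) : {set G} := [set v | 0 < C v].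

Definition dominable (C : config) : Prop :=
  exists s : seq config,
    path pebbling_move C s /\ dominating (occupied (last C s)).

Definition always_dominable (m : nat) : Prop :=
  forall C : config, num_pebbles C = m -> dominable C.

(* The relation psi(G) = k, i.e. k is the least m with [always_dominable m]. *)
Definition domination_cover_pebbling_number (k : nat) : Prop :=
  always_dominable k /\ forall m, always_dominable m -> k <= m.

End Pebbling.

(* The vertices of B_n are the Boolean words of length at most n: the length is
   the depth, the empty word is the root, and a word u of length less than n has
   the two children false :: u and true :: u. *)
Section CompleteBinaryTree.
Variable n : nat.

Definition is_child (u v : n.-bseq bool) : bool :=
  [exists b : bool, v == b :: u :> seq bool].

Definition tree_adj : rel (n.-bseq bool) :=
  fun u v => is_child u v || is_child v u.

Lemma tree_adj_sym : symmetric tree_adj.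
Proof. by move=> u v; rewrite /tree_adj orbC. Qed.

Lemma tree_adj_irrefl : irreflexive tree_adj.
Proof.
move=> u; rewrite /tree_adj orbb; apply/existsP=> -[b /eqP /(congr1 size) /=].
by move/eqP; rewrite -[X in X == _]addn0 -addn1 eqn_add2l.
Qed.

Lemma tree_adj_connected u v : connect tree_adj u v.
Proof.
have root_to w : connect tree_adj [bseq] w.
  case: w => s; elim: s => [|b s IHs] szs.
    by apply: eq_connect0; apply: val_inj.
  have szs' : size s <= n by exact: ltnW.
  apply: connect_trans (IHs szs') (connect1 _).
  by apply/orP; left; apply/existsP; exists b.
apply: connect_trans (root_to v).
by rewrite (sym_connect_sym tree_adj_sym).
Qed.

Definition complete_binary_tree : graph :=
  Graph tree_adj_sym tree_adj_irrefl tree_adj_connected.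

End CompleteBinaryTree.

(* Main.v *)
Require Import Defs.
From mathcomp Require Import all_boot.
From mathcomp Require Import order ssralg ssrnum ssrint zify.

(** Both bounds come from comparing every configuration with the following
extremal one.  Fix a leaf, the stack leaf.  Among the other pairs of sibling
leaves there are 2 ^ (n - 1) - 1, and each receives one pebble, on one of its
two leaves; all the remaining pebbles are on the stack leaf.

Lower bound.  The scattered pebbles are useless: the sibling of such a leaf is
dominated most cheaply from their common parent, which then dominates the leaf
too, and a pebble can leave the leaf only after a second one has been brought
there at a higher price than what comes back.  To make this precise, charge
2 ^ d for a pebble at distance d from the stack leaf, except that one pebble on
each of the chosen leaves is free.  No pebbling move increases the total charge
([potential_decr], [paid_decr]).  On the other hand the charge of a dominating
set is bounded below by induction on the height of subtrees ([cost_far],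
[cost_near], [cost_root]): the cheapest sets consist of the vertices of heights
1, 4, 7 and so on above the leaves, and if 3 divides n the root is then not
dominated, which is repaired most cheaply by its child on the way to the stack
leaf, for an additional 2 ^ (n - 1).  So the stack must contain at least that
cost, and one pebble less makes the configuration, or any smaller one, fail
([psi_minimal]).

Upper bound.  Given a set S of vertices to be occupied, define from the leaves
upwards the surplus of each vertex: its pebbles, minus one if it belongs to S,
plus what its children contribute, where a child with surplus x >= 0 sends
x / 2 pebbles up and a child with surplus x < 0 asks for - x pebbles, that is
for - 2 x pebbles of its parent.  In a tree S can be occupied as soon as the
surplus of the root is nonnegative ([settle_subtree]).  The set S is chosen as
in the cheapest dominating sets, with one change that depends on the
configuration: the parent of two leaves that both carry an odd number of
pebbles would waste two pebbles, so the two leaves replace it in S, unless this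
has been done for its sibling, since their own parent relies on one of them
([target]).  What remains is to bound the number of pebbles of a subtree in
terms of the surplus of its root ([stack_bound]).  Pebbles are wasted most
effectively if one child holds all the excess and the other one only its useless
scattered pebbles, because an extra unit of surplus of a vertex is bought with
more and more pebbles; the induction is [stack_bound_step].  It gives exactly
the number of the extremal configuration when 3 does not divide n.  When it
does, S still misses the root: the root itself is added if it has something to
spare, or a child whose surplus is odd and would lose its last pebble anyway;
if neither is possible the bound improves by 2 ^ (n - 1)
([stack_bound_root]). *)

Import Order.TTheory GRing.Theory Num.Theory.

Set Implicit Arguments.
Unset Strict Implicit.
Unset Printing Implicit Defensive.

(** * Sums over the subtrees of a binary tree of words *)

Fixpoint subtree_sum (F : seq bool -> nat) h w :=
  F w + (if h is h'.+1 then
           subtree_sum F h' (false :: w) + subtree_sum F h' (true :: w)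
         else 0).

Lemma subtree_sumS F h w : subtree_sum F h.+1 w =
  F w + (subtree_sum F h (false :: w) + subtree_sum F h (true :: w)).
Proof. by []. Qed.

Lemma suffix_child (w v : seq bool) :
  suffix w v = [|| v == w, suffix (false :: w) v | suffix (true :: w) v].
Proof.
apply/idP/idP => [/suffixP[s ->]|]; last first.
  case/or3P => [/eqP->|/suffixP[s ->]|/suffixP[s ->]]; first exact: suffix_refl.
    by apply/suffixP; exists (rcons s false); rewrite cat_rcons.
  by apply/suffixP; exists (rcons s true); rewrite cat_rcons.
case: (lastP s) => [|s' b]; first by rewrite eqxx.
by rewrite cat_rcons; case: b; rewrite suffix_suffix ?orbT.
Qed.

Lemma suffix_not_child b (w : seq bool) : suffix (b :: w) w = false.
Proof. by apply/negP => /size_suffix; rewrite ltnn. Qed.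

Lemma suffix_siblings b (w v : seq bool) :
  suffix (b :: w) v -> suffix (~~ b :: w) v = false.
Proof.
move=> /suffixP[s ->]; apply/negP; rewrite suffixE /=.
by rewrite size_cat /= addnK drop_size_cat // eqseq_cons; case: b.
Qed.

(** This form, over all the vertices with a suffix test as weight, lets the
induction split the subtree of w into w and the subtrees of its children. *)
Lemma sum_subtree n F h (w : seq bool) : size w + h = n ->
  \sum_(v : n.-bseq bool) suffix w v * F (val v) = subtree_sum F h w.
Proof.
have pointE (u : seq bool) : size u <= n ->
    \sum_(v : n.-bseq bool) (val v == u) * F (val v) = F u.
  move=> le_u; rewrite (bigD1 (Bseq le_u)) //= eqxx mul1n big1 ?addn0 //.
  by move=> v; rewrite -val_eqE /= => /negPf->.
elim: h w => [|h IHh] w sz_w /=.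
  rewrite addn0 -(pointE w); last by lia.
  apply: eq_bigr => v _; congr (nat_of_bool _ * _).
  rewrite suffixE; have := size_bseq v; move: sz_w; rewrite addn0 => -> le_v.
  by have /eqP-> : size v - n == 0; rewrite ?drop0.
rewrite -!IHh /=; try lia; rewrite -(pointE w); last by lia.
rewrite -!big_split /=; apply: eq_bigr => v _.
rewrite -!mulnDl; congr (_ * _); rewrite suffix_child.
case: eqVneq => [->|_] /=; first by rewrite !suffix_not_child.
by case: (boolP (suffix (false :: w) v)) => //= /suffix_siblings/=->.
Qed.

Lemma sum_words n F :
  \sum_(v : n.-bseq bool) F (val v) = subtree_sum F n [::].
Proof.
rewrite -(@sum_subtree n) //; apply: eq_bigr => v _.
by rewrite suffix0s mul1n.
Qed.

(** * Surplus of a vertex with respect to a set to be occupied *)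

(** What a child with surplus x contributes to its parent: a pebble sent up
costs two pebbles of the child, and a missing pebble of the child costs two
pebbles of the parent. *)
Definition upflow (x : int) : int :=
  match x with Posz k => k./2%:Z | Negz k => (- (k.+1).*2%:Z)%R end.

Lemma upflow_ge0 x :
  (0 <= x -> 0 <= upflow x /\ 2 * upflow x <= x /\ x <= 2 * upflow x + 1)%R.
Proof. by case: x => k //=; lia. Qed.

Lemma upflow_lt0 x : (x < 0 -> upflow x = 2 * x)%R.
Proof. by case: x => k //=; lia. Qed.

Fixpoint surplus (S : pred (seq bool)) (c : seq bool -> nat) h w : int :=
  ((c w)%:Z - (S w)%:Z +
  if h is h'.+1 then
    upflow (surplus S c h' (false :: w)) + upflow (surplus S c h' (true :: w))
  else 0)%R.

Lemma eq_surplus (S S' : pred (seq bool)) (c c' : seq bool -> nat) h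
    (w : seq bool) :
    (forall v, suffix w v -> S v = S' v) ->
    (forall v, suffix w v -> c v = c' v) ->
  surplus S c h w = surplus S' c' h w.
Proof.
elim: h w => [|h IHh] w eq_S eq_c /=; rewrite eq_S ?eq_c ?suffix_refl //.
by rewrite !IHh // => v sv; (apply: eq_S || apply: eq_c);
  rewrite suffix_child sv ?orbT.
Qed.

(** The surplus of the root of a subtree depends on its own pebbles and its own
membership through their difference alone.  Used to follow the surplus when
pebbles reach that root, or when it joins the set. *)
Lemma surplus_root (S S' : pred (seq bool)) (c c' : seq bool -> nat) h
    (w : seq bool) :
    (forall v, suffix w v -> v != w -> S v = S' v /\ c v = c' v) ->
  (surplus S' c' h w - (c' w)%:Z + (S' w)%:Z =
   surplus S c h w - (c w)%:Z + (S w)%:Z)%R.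
Proof.
case: h => [|h] eq_Sc /=; first by move: (S w) (S' w) => Sw S'w; lia.
have eq_kid b : surplus S' c' h (b :: w) = surplus S c h (b :: w).
  have eq_Sc' v : suffix (b :: w) v -> S v = S' v /\ c v = c' v.
    move=> sv; apply: eq_Sc; last first.
      by apply: contraTneq sv => ->; rewrite suffix_not_child.
    by rewrite suffix_child; case: (b) sv => ->; rewrite ?orbT.
  by apply/esym/eq_surplus => v /eq_Sc'[].
by rewrite !eq_kid; move: (upflow _) (upflow _) (S w) (S' w) => a b Sw S'w; lia.
Qed.

(** * Sequences of pebbling moves *)

Section Moves.
Variable G : graph.

Definition reach (C C' : config G) : Prop :=
  exists2 s, path (@pebbling_move G) C s & last C s = C'.

Lemma reach_refl C : reach C C.
Proof. by exists [::]. Qed.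

Lemma reach_trans C1 C2 C3 : reach C1 C2 -> reach C2 C3 -> reach C1 C3.
Proof.
move=> [s p_s <-] [t p_t <-]; exists (s ++ t); last by rewrite last_cat.
by rewrite cat_path p_s.
Qed.

Definition transfer (C : config G) (u v : G) k : config G :=
  [ffun x => if x == u then C x - k.*2 else if x == v then C x + k else C x].

Lemma reach_transfer (C : config G) u v k :
  adj u v -> k.*2 <= C u -> reach C (transfer C u v k).
Proof.
move=> uv; have neq_vu: v != u.
  by apply: contraTneq uv => ->; rewrite adj_irrefl.
elim: k => [|k IHk] le_k.
  exists [::] => //=; apply/ffunP => x; by rewrite ffunE subn0 addn0 !if_same.
have /IHk : k.*2 <= C u by lia.
move=> /reach_trans; apply.
exists [:: transfer C u v k.+1] => //=; rewrite andbT.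
apply/existsP; exists u; apply/existsP; exists v; rewrite uv ffunE eqxx /=.
apply/andP; split; first lia.
apply/eqP/ffunP => x; rewrite !ffunE.
by case: eqVneq => [|_]; [lia|case: eqVneq => [|_] //; lia].
Qed.

End Moves.

(** * Occupying a prescribed set of vertices of the tree *)

Section Tree.
Variable n : nat.
Local Notation G := (complete_binary_tree n).

Definition vtx (w : seq bool) : G := insubd [bseq] w.

(** A configuration read on all words, with no pebble off the tree; the bounds
below are about such functions. *)
Definition pile (C : config G) (w : seq bool) : nat :=
  if size w <= n then C (vtx w) else 0.

Lemma val_vtx w : size w <= n -> val (vtx w) = w.
Proof. by move=> le_w; rewrite insubdK. Qed.

Lemma vtxK (v : G) : vtx (val v) = v.
Proof. exact: valKd. Qed.

Lemma pile_val C (v : G) : pile C (val v) = C v.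
Proof. by rewrite /pile vtxK size_bseq. Qed.

Lemma tree_adj_child b w : size w < n -> adj (vtx w) (vtx (b :: w)).
Proof.
move=> lt_w; apply/orP; left; apply/existsP; exists b.
by rewrite -[_ == _]/(val _ == _ :: val _) !val_vtx // ltnW.
Qed.

Lemma pile_transfer C (u v : seq bool) k (w : seq bool) :
    size u <= n -> size v <= n ->
  pile (transfer C (vtx u) (vtx v) k) w =
    if w == u then pile C w - k.*2
    else if w == v then pile C w + k else pile C w.
Proof.
move=> le_u le_v; rewrite /pile; case: leqP => [le_w|gt_w]; last first.
  by rewrite !(negPf (contraTneq _ gt_w)) // => ->; rewrite -leqNgt.
by rewrite ffunE -!val_eqE /= !val_vtx.
Qed.

Variable S : pred (seq bool).

Definition settled (C C' : config G) h w := [/\ reach C C',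
  forall v, ~~ suffix w v -> pile C' v = pile C v,
  (surplus S (pile C) h w + (S w)%:Z <= (pile C' w)%:Z)%R
  & forall v, suffix w v -> v != w -> size v <= n -> S v -> 0 < pile C' v].

Definition served (C C' : config G) h b w := [/\ reach C C',
  forall v, ~~ suffix (b :: w) v -> v != w -> pile C' v = pile C v,
  ((pile C' w)%:Z = (pile C w)%:Z + upflow (surplus S (pile C) h (b :: w)))%R
  & forall v, suffix (b :: w) v -> size v <= n -> S v -> 0 < pile C' v].

(** One child of w, of either sign, exchanges pebbles with w: a child with a
surplus first settles its subtree and then sends up what it can, a child in
need first receives what it misses, which brings its surplus to zero. *)
Lemma serve_child h b (w : seq bool) C :
    (forall C, (0 <= surplus S (pile C) h (b :: w))%R ->
       exists C', settled C C' h (b :: w)) ->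
    size w < n ->
    (0 <= (pile C w)%:Z + upflow (surplus S (pile C) h (b :: w)))%R ->
  exists C', served C C' h b w.
Proof.
move=> IH lt_w; set x := surplus _ _ _ _ => ge_C.
have sbw : size (b :: w) <= n by [].
have sw := ltnW lt_w.
have neq_bw : (b :: w == w) = false.
  by apply/negP => /eqP /(congr1 size) /= /eqP; rewrite (gtn_eqF (leqnn _)).
have adj_wb := tree_adj_child b lt_w.
case: (ltrP x 0)%R => [x_lt0|x_ge0].
  have x2 := upflow_lt0 x_lt0.
  have [k def_k] : exists k : nat, (x = - k%:Z)%R by exists `|x|%N; lia.
  pose C1 := transfer C (vtx w) (vtx (b :: w)) k.
  have pC1 : pile C1 =1 _ := fun v => pile_transfer C k v sw sbw.
  have C1w : ((pile C1 w)%:Z = (pile C w)%:Z + upflow x)%R.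
    by rewrite pC1 eqxx; lia.
  have surC1 : surplus S (pile C1) h (b :: w) = 0%R.
    have := @surplus_root S S (pile C) (pile C1) h (b :: w).
    rewrite [pile C1 (b :: w)]pC1 neq_bw eqxx -/x => e'.
    suff: (surplus S (pile C1) h (b :: w) = x + k%:Z)%R by lia.
    have /e' : (forall v, suffix (b :: w) v -> v != b :: w ->
        S v = S v /\ pile C v = pile C1 v).
      move=> v sv neq_v; split=> //; rewrite pC1 (negPf neq_v).
      by rewrite (negPf (contraTneq _ sv)) // => ->; rewrite suffix_not_child.
    by move: (surplus _ _ _ _) (S _) => y Sy; lia.
  have [|C2 [C12 out2 root2 in2]] := IH C1; first by rewrite surC1.
  exists C2; split.
  - apply: reach_trans C12; apply: reach_transfer => //.
    by move: ge_C; rewrite /pile sw; lia.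
  - move=> v sv neq_v; rewrite out2 // pC1 (negPf neq_v).
    by rewrite (negPf (contraNneq _ sv)) // => ->; rewrite suffix_refl.
  - by rewrite out2 // suffix_not_child.
  move=> v sv le_v Sv; case: (eqVneq v (b :: w)) Sv => [->|neq_v] Sv.
    by move: root2; rewrite surC1 Sv; lia.
  exact: in2.
have [|C1 [C1r out1 root1 in1]] := IH C; first by [].
have [k def_k] : exists k, upflow x = Posz k.
  by have [? _] := upflow_ge0 x_ge0; exists `|upflow x|%N; lia.
have [_ [x2 _]] := upflow_ge0 x_ge0.
pose C2 := transfer C1 (vtx (b :: w)) (vtx w) k.
have pC2 : pile C2 =1 _ := fun v => pile_transfer C1 k v sbw sw.
have C1w : pile C1 w = pile C w by rewrite out1 // suffix_not_child.
exists C2; split.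
- apply: reach_trans C1r _; apply: reach_transfer; first by rewrite adj_sym.
  by move: root1; rewrite /pile sbw -/x; lia.
- move=> v sv neq_v; rewrite pC2 (negPf neq_v) out1 //.
  by rewrite (negPf (contraNneq _ sv)) // => ->; rewrite suffix_refl.
- by rewrite pC2 eq_sym neq_bw eqxx C1w def_k; lia.
move=> v sv le_v Sv; rewrite pC2.
case: (eqVneq v (b :: w)) Sv => [->|neq_v] Sv.
  by move: root1; rewrite Sv -/x; lia.
have := in1 v sv neq_v le_v Sv.
by case: ifP => _; lia.
Qed.

(** The surplus is attained: everything prescribed below w gets occupied and w
keeps its surplus on top of the pebble that it may need itself. *)
Lemma settle_subtree h (w : seq bool) C : size w + h = n ->
  (0 <= surplus S (pile C) h w)%R -> exists C', settled C C' h w.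
Proof.
elim: h w C => [|h IHh] w C sz_w x_ge0.
  exists C; split => //; [exact: reach_refl | by move=> /=; lia | move=> v].
  move=> /suffixP[s ->]; case: s => [|b s]; first by rewrite eqxx.
  by move=> _; rewrite size_cat /=; lia.
have lt_w : size w < n by lia.
have IH b C' := @IHh (b :: w) C' ltac:(by move=> /=; lia).
(* At least one child can be served first: one that contributes, or any child
   if both are in need. *)
have [b ge_b] : exists b,
    (0 <= (pile C w)%:Z + upflow (surplus S (pile C) h (b :: w)))%R.
  move: x_ge0 => /=; set x0 := upflow _; set x1 := upflow _ => x_ge0.
  by case: (lerP 0 x0)%R => ?; [exists false | exists true];
    rewrite -/x0 -/x1; lia.
have [C1 [C1r out1 root1 in1]] := serve_child (IH b) lt_w ge_b.
have sib v : suffix (~~ b :: w) v -> ~~ suffix (b :: w) v && (v != w).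
  move=> sv; rewrite -[b]negbK (suffix_siblings sv).
  by apply: contraTneq sv => ->; rewrite suffix_not_child.
have sur1 : surplus S (pile C1) h (~~ b :: w) =
    surplus S (pile C) h (~~ b :: w).
  by apply: eq_surplus => // v /sib /andP[nsv neq_v]; rewrite out1.
have def_x : (surplus S (pile C) h.+1 w + (S w)%:Z = (pile C1 w)%:Z +
    upflow (surplus S (pile C1) h (~~ b :: w)))%R.
  rewrite sur1 root1 /=; case: (b) => /=;
    by move: (upflow _) (upflow _) (S w) => x1 x2 Sw; lia.
have [|C2 [C2r out2 root2 in2]] := serve_child (IH (~~ b)) lt_w (C := C1).
  by rewrite -def_x; lia.
exists C2; split.
- exact: reach_trans C2r.
- move=> v; rewrite suffix_child !negb_or => /and3P[neq_v nsv0 nsv1].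
  by rewrite out2 ?out1 //; case: (b).
- by rewrite root2 def_x.
move=> v sv neq_v le_v Sv.
case: (boolP (suffix (~~ b :: w) v)) => [|nsv]; first by move=> /in2; apply.
rewrite out2 // in1 //; move: sv nsv; rewrite suffix_child (negPf neq_v) /=.
by case: (b) => /= /orP[->|->].
Qed.
End Tree.

(** * Pebbles of a subtree against the surplus of its root *)

Lemma upflow_cases x :
  (0 <= x /\ 0 <= upflow x /\ 2 * upflow x <= x <= 2 * upflow x + 1 \/
   x < 0 /\ upflow x = 2 * x)%R.
Proof. by case: x => k /=; lia. Qed.

(** The charge of the vertices of heights 1, 4, 7 and so on in a subtree of
height h without the stack leaf, when a pebble at its root is charged 1. *)
Fixpoint far_cost h :=
  if h is h'.+1 then 4 * far_cost h' + (h %% 3 == 1) else 0.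

(** The same for a subtree of height h with the stack leaf, when a pebble at
the stack leaf is charged 1: the child away from the stack leaf is at distance
h + 1 from it. *)
Fixpoint near_cost h :=
  if h is h'.+1 then
    near_cost h' + 2 ^ h'.+2 * far_cost h' + (h %% 3 == 1) * 2 ^ h
  else 0.

Lemma far_costS h : far_cost h.+1 = 4 * far_cost h + (h.+1 %% 3 == 1).
Proof. by []. Qed.

Lemma near_costS h :
  near_cost h.+1 =
  near_cost h + 2 ^ h.+2 * far_cost h + (h.+1 %% 3 == 1) * 2 ^ h.+1.
Proof. by []. Qed.

Lemma far_cost_gt0 h : 0 < h -> 0 < far_cost h.
Proof. by elim: h => // -[|h] IHh _ //=; have := IHh isT => /=; lia. Qed.

Lemma near_cost_le h : 0 < h ->
  near_cost h + 2 ^ h.+1 <= 2 ^ h.+2 * far_cost h + 2.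
Proof.
elim: h => // -[|h] IHh _ //; move: (IHh isT) (far_cost_gt0 (ltn0Sn h)).
rewrite [near_cost _.+2]near_costS [far_cost h.+2]far_costS.
move: (far_cost h.+1) (near_cost h.+1) (h.+2 %% 3 == 1) => F N e;
  rewrite !expnS; move: (2 ^ h) => Q lt_N F_gt0; have := leq_pmulr Q F_gt0;
  case: e; lia.
Qed.

(** Two bounds on the number p of pebbles of a subtree of height h in terms of
the surplus y of its root.  The first one is attained at the smallest possible
surplus, - far_cost h, where 2 ^ (h - 1) pebbles are wasted; the second one is
attained when a single leaf holds all the excess.  The t pebbles stand for an
addition at the root of the subtree; they carry the second bound over to
surpluses below -1. *)
Definition stack_bound h (p : nat) (y : int) : Prop :=
  (p%:Z <= (2 ^ h.-1)%:Z + (2 ^ h.+1)%:Z * (y + (far_cost h)%:Z) /\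
   forall t : nat, -1 <= y + t%:Z ->
     p%:Z + t%:Z <=
     (2 ^ h)%:Z * (y + t%:Z + 1) + (2 ^ h.-1)%:Z - 2 + (near_cost h)%:Z)%R.

(** The induction starts at height 2, where one parent of two leaves may have
been replaced by its leaves; x0 and x1 are the surpluses of the children. *)
Lemma stack_bound_base (p c0 : nat) (x0 x1 : int) :
  (-1 <= x0 -> -1 <= x1 -> p%:Z <= c0%:Z + 2 * x0 + 2 * x1 + 6 ->
  stack_bound 2 p (c0%:Z + (upflow x0 + upflow x1)))%R.
Proof.
move=> ? ? ?; rewrite /stack_bound (_ : far_cost 2 = 4) //.
rewrite (_ : near_cost 2 = 10) //.
rewrite (_ : 2 ^ 2.-1 = 2) // (_ : 2 ^ 3 = 8) // (_ : 2 ^ 2 = 4) //.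
have := upflow_cases x0; have := upflow_cases x1.
move: (upflow x0) (upflow x1) => z0 z1 H1 H0.
split => [|t]; lia.
Qed.

(** What the pebbles of a child are worth one level higher: the steep second
inequality applies to a child with something to give, the first one to a child
in need. *)
Lemma stack_bound_child h (p : nat) (y : int) : 0 < h -> stack_bound h p y ->
  let Q := Posz (2 ^ h.-1) in let M := Posz (far_cost h) in
  let N := Posz (near_cost h) in
  (0 <= upflow y /\ p%:Z <= 4 * (Q * upflow y) + 5 * Q - 2 + N \/
   [/\ upflow y <= -2, 0 <= Q * upflow y + 2 * (Q * M)
     & p%:Z <= Q + 2 * (Q * upflow y) + 4 * (Q * M)])%R.
Proof.
case: h => [|k] // _ [low /(_ 0) high]; move: low high.
rewrite succnK !expnS; have: 0 < 2 ^ k by rewrite expn_gt0.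
move: (2 ^ k) (far_cost _) (near_cost _) => Q M N Q_gt0 low high.
have [[y_ge0 [z_ge0 /andP[_ le_y]]]|[y_lt0 def_z]] := upflow_cases y.
  left; split=> //; have {}high := high ltac:(lia).
  have : (Q%:Z * y <= Q%:Z * (2 * upflow y + 1))%R by apply: ler_wpM2l.
  move: (upflow y) high => z; lia.
right; have yM : (0 <= y + M%:Z)%R.
  case: (lerP 0 (y + M%:Z))%R => // yM_lt0.
  have : (Q%:Z * (y + M%:Z) <= Q%:Z * (-1))%R by apply: ler_wpM2l; lia.
  lia.
have : (0 <= Q%:Z * (y + M%:Z))%R by apply: mulr_ge0.
by rewrite def_z; split; lia.
Qed.

(** If both children give, the bound is not attained; it is if one child gives
and the other has its smallest surplus. *)
Lemma stack_bound_step h (p0 p1 p2 : nat) (y1 y2 : int) (e : bool) : 1 < h ->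
  e = (h.+1 %% 3 == 1) -> stack_bound h p1 y1 -> stack_bound h p2 y2 ->
  stack_bound h.+1 (p0 + (p1 + p2)) (p0%:Z - e%:Z + (upflow y1 + upflow y2))%R.
Proof.
case: h => [|k] // lt_k def_e /(stack_bound_child (ltn0Sn k)) child1.
move=> /(stack_bound_child (ltn0Sn k)) child2.
have := near_cost_le (ltn0Sn k); have M_gt0 := far_cost_gt0 (ltn0Sn k).
rewrite /stack_bound [near_cost k.+2]near_costS [far_cost k.+2]far_costS -def_e.
move: M_gt0 child1 child2.
move: (far_cost k.+1) (near_cost k.+1) => M N M_gt0; rewrite !succnK !expnS.
have: 2 <= 2 ^ k by rewrite (@leq_exp2l 2 1).
move: (2 ^ k) (upflow y1) (upflow y2) => Q z1 z2 Q_gt1 child1 child2 lt_N.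
have le_QM := leq_pmulr Q M_gt0.
have Qz_ge0 z : (0 <= z -> 0 <= Q%:Z * z)%R by move=> ?; apply: mulr_ge0.
have Qp0 : p0 <= Q * p0 by apply: leq_pmull; lia.
split => [|t].
  by case: child1 => [[/Qz_ge0 ? ?]|[? ? ?]];
    case: child2 => [[/Qz_ge0 ? ?]|[? ? ?]];
    case: (e); lia.
have Qt : t <= Q * t by apply: leq_pmull; lia.
move=> Y_ge; have Qs : (0 <= Q%:Z * (p0%:Z + t%:Z + z1 + z2 + 1))%R.
  by apply: Qz_ge0; lia.
by case: child1 => [[/Qz_ge0 ? ?]|[? ? ?]];
    case: child2 => [[/Qz_ge0 ? ?]|[? ? ?]];
  case: (e) Y_ge; lia.
Qed.

(** * The set to be occupied *)

Section Target.
Variables (n : nat) (c : seq bool -> nat).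

Definition both_odd q := odd (c (false :: q)) && odd (c (true :: q)).

(** The parents of leaves that are replaced by their two leaves.  The sibling
condition leaves in the set at least one child of every vertex of height 2. *)
Definition spared q :=
  if q is b :: g then both_odd q && (~~ b || ~~ both_odd (false :: g))
  else false.

Definition target (w : seq bool) :=
  match n - size w with
  | 0 => if w is _ :: q then spared q else false
  | 1 => ~~ spared w
  | h => h %% 3 == 1
  end.

Lemma target_height h (w : seq bool) : size w + h = n -> target w =
  match h with
  | 0 => if w is _ :: q then spared q else false
  | 1 => ~~ spared w
  | h => h %% 3 == 1
  end.
Proof.
by move=> sz_w; rewrite /target -sz_w addKn; case: h {sz_w} => [|[]].
Qed.

(** Prescribing a leaf costs nothing: it is prescribed only if its number of
pebbles is odd, and then its last pebble could not have moved. *)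
Lemma upflow_leaf b (q : seq bool) : size q + 1 = n ->
  upflow (surplus target c 0 (b :: q)) = Posz (c (b :: q))./2.
Proof.
move=> sz_q; rewrite /= addr0 (@target_height 0) /=; last lia.
case: (boolP (spared q)) => [sp|_]; last by rewrite subr0.
have : odd (c (b :: q)) by case: q {sz_q} sp => // b' g /andP[/andP[]]; case: b.
case: (c _) => // m odd_m; rewrite (_ : _ - _ = m%:Z)%R /=; lia.
Qed.

Lemma surplus_leaf_parent (q : seq bool) : size q + 1 = n ->
  (surplus target c 1 q = (c q)%:Z - (~~ spared q)%:Z
     + (c (false :: q))./2%:Z + (c (true :: q))./2%:Z)%R.
Proof.
move=> sz_q; rewrite -addrA -!upflow_leaf // -(@target_height 1) //.
Qed.

(** A parent of two leaves has, with them, at most three pebbles more than twice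
its surplus, or four if both leaves are odd and it is not spared; but then its
sibling is spared and has at most two more. *)
Lemma pebbles_height2 (g : seq bool) : size g + 2 = n ->
  let x b := surplus target c 1 (b :: g) in
  [/\ (-1 <= x false)%R, (-1 <= x true)%R &
  ((subtree_sum c 2 g)%:Z <= (c g)%:Z + 2 * x false + 2 * x true + 6)%R].
Proof.
move=> sz_g x; rewrite {}/x !surplus_leaf_parent /=; try lia.
rewrite /spared /both_odd /=.
have half b b' := odd_double_half (c [:: b, b' & g]).
move: (half false false) (half false true) (half true false) (half true true).
by do 4!case: (odd _); move=> /= ? ? ? ?; split; lia.
Qed.

Lemma target_stack_bound h (w : seq bool) : 1 < h -> size w + h = n ->
  stack_bound h (subtree_sum c h w) (surplus target c h w).
Proof.
elim: h w => // h IHh w; rewrite ltnS leq_eqVlt.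
case/orP => [/eqP<-{h IHh}|gt_h] sz_w.
  have [] := pebbles_height2 sz_w; set x0 := surplus _ _ _ _;
    set x1 := surplus _ _ _ _.
  move=> ge_x0 ge_x1 le_p.
  have := stack_bound_base ge_x0 ge_x1 le_p.
  by rewrite -/(surplus _ _ 2 w) [surplus _ _ 2 w]/=
    (@target_height 2) //= subr0.
rewrite [subtree_sum _ _ _]/= [surplus _ _ _ _]/=.
apply: stack_bound_step => //.
  by rewrite (@target_height h.+1) //; case: (h) gt_h.
all: by apply: IHh => //=; lia.
Qed.
End Target.

(** * Domination on words *)

Definition touched n (S : pred (seq bool)) (w : seq bool) :=
  [|| S w, if w is _ :: u then S u else false
    | (size w < n) && (S (false :: w) || S (true :: w))].

Section Dominating.
Variable n : nat.
Local Notation G := (complete_binary_tree n).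

Lemma tree_adjP (u v : G) : reflect
  (exists b, val v = b :: val u \/ val u = b :: val v) (adj u v).
Proof.
apply: (iffP orP) => [[/existsP[b /eqP def_v]|/existsP[b /eqP def_u]]|].
- by exists b; left.
- by exists b; right.
by move=> [b [def_v|def_u]]; [left|right]; apply/existsP; exists b; apply/eqP.
Qed.

Lemma dominatingP (D : {set G}) : reflect
  (forall w : seq bool, size w <= n ->
     touched n (fun u => (size u <= n) && (vtx n u \in D)) w)
  (dominating D).
Proof.
apply: (iffP forallP) => [dom w le_w|dom v].
  have /orP[vD|/existsP[u /andP[uD /tree_adjP[b]]]] := dom (vtx n w).
    by rewrite /touched le_w vD.
  rewrite val_vtx // => -[def_w|def_u].
    by rewrite /touched def_w (size_bseq u) vtxK uD orbT.
  have := size_bseq u; rewrite /touched def_u /= => lt_w.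
  by rewrite lt_w -[u]vtxK def_u in uD *;
    case: b uD {def_u} => ->; rewrite ?orbT.
have := dom (val v) (size_bseq v).
case/or3P => [/andP[_]||/andP[lt_v /orP[]/andP[_ kD]]].
- by rewrite vtxK => ->.
- case def_v: (val v) => [|b u] // /andP[le_u uD]; apply/orP; right.
  apply/existsP; exists (vtx n u); rewrite uD; apply/tree_adjP.
  by exists b; left; rewrite val_vtx.
- apply/orP; right; apply/existsP; exists (vtx n (false :: val v)); rewrite kD.
  by apply/tree_adjP; exists false; right; rewrite val_vtx.
apply/orP; right; apply/existsP; exists (vtx n (true :: val v)); rewrite kD.
by apply/tree_adjP; exists true; right; rewrite val_vtx.
Qed.

Lemma sub_touched (S S' : pred (seq bool)) (w : seq bool) : size w <= n ->
  (forall v, size v <= n -> S v -> S' v) -> touched n S w -> touched n S' w.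
Proof.
move=> le_w sub.
case/or3P => [/(sub _ le_w)|sSw|/andP[lt_w /orP[]/(sub (_ :: w) lt_w) Sw]];
  rewrite /touched; first by move=> ->.
- by case: w le_w sSw => // b w /ltnW le_w /(sub _ le_w) ->; rewrite orbT.
- by rewrite lt_w Sw !orbT.
by rewrite lt_w Sw !orbT.
Qed.

Lemma surplus_dominable (S : pred (seq bool)) (C : config G) :
    (forall w, size w <= n -> touched n S w) ->
    (0 <= surplus S (pile C) n [::])%R -> dominable C.
Proof.
move=> dom ge0.
have [//|C' [[s path_s last_s] _ root' in']] := settle_subtree (C := C) _ ge0.
exists s; split => //; rewrite last_s; apply/dominatingP => w le_w.
have S_occ v : size v <= n -> S v -> vtx n v \in occupied C'.
  move=> le_v Sv; rewrite inE; suff: 0 < pile C' v by rewrite /pile le_v.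
  case: (eqVneq v [::]) Sv => [->|neq_v] Sv; last first.
    by apply: in' => //; apply: suffix0s.
  rewrite -ltz_nat; apply: lt_le_trans root'; rewrite Sv; move: ge0.
  by move: (surplus _ _ _ _) => x; lia.
apply: (sub_touched le_w _ (dom w le_w)) => v le_v /(S_occ v le_v) ->.
by rewrite le_v.
Qed.
End Dominating.

(** A leaf and its parent are dominated by that parent or by the leaves that
replace it.  Above them heights 1, 4, 7 and so on dominate everything, except
for a root of height divisible by 3, since only a parent could dominate it. *)
Lemma target_touched n c h (w : seq bool) : 1 < n -> size w + h = n ->
  (w != [::]) || (n %% 3 != 0) -> touched n (target n c) w.
Proof.
move=> gt_n sz_w; rewrite /touched (target_height c sz_w).
have lt_w : 0 < h -> size w < n by lia.
have kid b : 0 < h -> size (b :: w) + h.-1 = n by move=> /=; lia.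
case: h sz_w lt_w kid => [|[|[|h]]] sz_w lt_w kid ncorner.
- case: w {lt_w kid ncorner} sz_w => [|b q] sz_w.
    by move: sz_w gt_n => /=; lia.
  by rewrite (@target_height _ _ 1) ?orbA ?orbN //; move: sz_w => /=; lia.
- case: (boolP (spared c w)) => //= sp; rewrite lt_w //=.
  by rewrite !(target_height c (kid _ isT)) /= sp !orbT.
- rewrite lt_w // !(target_height c (kid _ isT)) /=.
  by case: (both_odd c (false :: w)); rewrite /= ?andbF ?orbT.
have high v k : 1 < k -> size v + k = n -> target n c v = (k %% 3 == 1).
  by move=> gt_k /(target_height c) ->; case: k gt_k => [|[]].
have [h0|h1|h2] : [\/ h.+3 %% 3 = 0, h.+3 %% 3 = 1 | h.+3 %% 3 = 2].
  by move: (ltn_pmod h.+3 (isT : 0 < 3)); case: (_ %% _) => [|[|[|]]] //;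
    [constructor 1 | constructor 2 | constructor 3].
- case: w ncorner sz_w {lt_w kid} => [|b q] /=.
    by move=> n0 sz_n; move: n0; rewrite -sz_n add0n h0.
  move=> _ sz_w; rewrite (high q h.+4) ?orbT //; last by lia.
  by rewrite -[h.+4]addn1 -modnDml h0 orbT.
- by rewrite h1.
rewrite lt_w // (high (false :: w) h.+2 isT (kid false isT)).
suff -> : h.+2 %% 3 = 1 by rewrite !orbT.
lia.
Qed.

(** * Upper bound *)

Lemma upflow_pred (x : int) : (upflow (x - 1) = upflow x \/
  x < 0 \/ x = 2 * upflow x)%R.
Proof.
have := upflow_cases x; have := upflow_cases (x - 1)%R.
move: (upflow x) (upflow _) => z z'; lia.
Qed.

(** The case of a root of height divisible by 3 that has surplus 0, while each
child would contribute less with one pebble less.  A contributing child then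
has an even surplus, while the extremal case of [stack_bound_step] has an odd
one; this is where 2 ^ h pebbles are gained. *)
Lemma stack_bound_root h (p0 p1 p2 : nat) (y1 y2 : int) : 1 < h ->
    h.+1 %% 3 = 0 -> stack_bound h p1 y1 -> stack_bound h p2 y2 ->
    upflow (y1 - 1) <> upflow y1 -> upflow (y2 - 1) <> upflow y2 ->
    (p0%:Z + (upflow y1 + upflow y2) = 0)%R ->
  p0 + (p1 + p2) + 2 <= 2 ^ h.+1 + near_cost h.+1.
Proof.
case: h => [|k] // lt_k h0 b1 b2 n1 n2.
have := near_cost_le (ltn0Sn k); have M_gt0 := far_cost_gt0 (ltn0Sn k).
rewrite [near_cost k.+2]near_costS h0 mul0n addn0.
have even_child p y : stack_bound k.+1 p y -> upflow (y - 1) <> upflow y ->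
  let Q := Posz (2 ^ k) in let M := Posz (far_cost k.+1) in
  let N := Posz (near_cost k.+1) in
  (0 <= upflow y /\ p%:Z <= 4 * (Q * upflow y) + 3 * Q - 2 + N \/
   [/\ upflow y <= -2, 0 <= Q * upflow y + 2 * (Q * M)
     & p%:Z <= Q + 2 * (Q * upflow y) + 4 * (Q * M)])%R.
  move=> b ny; have := stack_bound_child (ltn0Sn k) b.
  case=> [[z_ge0 _]|]; last by right.
  left; split=> //; case: (upflow_pred y) => // -[y_lt0|def_y].
    by have := upflow_lt0 y_lt0; lia.
  have {b} [_ /(_ 0 ltac:(lia))] := b.
  have := congr1 (fun z => ((2 ^ k)%:Z * z)%R) def_y.
  by rewrite expnS succnK; move: (2 ^ k) (upflow y) => Q z; lia.
move: {n1 n2 b1 b2} (even_child _ _ b1 n1) (even_child _ _ b2 n2).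
rewrite !expnS; have: 0 < 2 ^ k by rewrite expn_gt0.
move: M_gt0; move: (far_cost _) (near_cost _) (2 ^ k) => M N Q M_gt0 Q_gt0.
move: (upflow y1) (upflow y2) => z1 z2 child1 child2 lt_N z0.
have le_QM := leq_pmulr Q M_gt0.
have Qp0 : p0 <= Q * p0 by apply: leq_pmull; lia.
have Qz0 : (Q%:Z * (p0%:Z + (z1 + z2)) = 0)%R by rewrite z0 mulr0.
have Qz_ge0 z : (0 <= z -> 0 <= Q%:Z * z)%R by move=> ?; apply: mulr_ge0.
by case: child1 => [[/Qz_ge0 ? ?]|[? ? ?]];
    case: child2 => [[/Qz_ge0 ? ?]|[? ? ?]]; lia.
Qed.

(** The scattered pebbles, the charge of heights 1, 4, 7 and so on, and the
supplement for a root that these heights do not dominate. *)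
Definition psi n :=
  2 ^ n.-1 - 1 + near_cost n + (if n %% 3 == 0 then 2 ^ n.-1 else 0).

Definition add_target n c (u : seq bool) : pred (seq bool) :=
  [pred v | (v == u) || target n c v].

Lemma psi_dominable n (C : config (complete_binary_tree n)) : 1 < n ->
  psi n <= num_pebbles C -> dominable C.
Proof.
case: n C => // h C gt_n; pose c := pile C.
have -> : num_pebbles C = subtree_sum c h.+1 [::].
  by rewrite -sum_words; apply: eq_bigr => v _; apply/esym; apply: pile_val.
have Pgt0 : 0 < 2 ^ h by rewrite expn_gt0.
have P2 : 2 ^ h.+1 = 2 * 2 ^ h by rewrite expnS.
have SB := target_stack_bound c gt_n (add0n h.+1 : size [::] + h.+1 = h.+1).
move=> le_psi; set y := surplus (target h.+1 c) c h.+1 [::] in SB.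
have y_ge0 : (0 <= y)%R.
  case: (lerP 0 y) => // y_lt0; case: SB => _ /(_ `|(-1 - y)%R|%N).
  rewrite (_ : y + _ = -1)%R; last by lia.
  move=> /(_ isT); rewrite /psi in le_psi; move: le_psi; case: ifP => _; lia.
case n0 : (h.+1 %% 3 == 0); last first.
  apply: (surplus_dominable (S := target h.+1 c)) => // w le_w.
  apply: (@target_touched _ _ (h.+1 - size w)) => //; first by rewrite subnKC.
  by rewrite n0 orbT.
have add_touched u : touched h.+1 (add_target h.+1 c u) [::] ->
  forall w, size w <= h.+1 -> touched h.+1 (add_target h.+1 c u) w.
  move=> tu w le_w; case: (eqVneq w [::]) => [->|nw] //.
  apply: (@sub_touched h.+1 (target h.+1 c)) => //.
    by move=> v _ tv; rewrite /add_target /= tv orbT.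
  by apply: (@target_touched _ _ (h.+1 - size w)) => //;
    [rewrite subnKC | rewrite nw].
have nroot : target h.+1 c [::] = false.
  rewrite (target_height c (add0n h.+1 : size [::] + h.+1 = h.+1)).
  by case: (h) gt_n n0 => [|k] // _ /eqP->.
have eq_kid u b : ~~ suffix (b :: [::]) u ->
    surplus (add_target h.+1 c u) c h [:: b] =
    surplus (target h.+1 c) c h [:: b].
  move=> su; apply: eq_surplus => // v sv /=.
  rewrite /add_target /=; case: (eqVneq v u) => /= [vu|_] //.
  by rewrite -vu sv in su.
have def_y : y = ((c [::])%:Z + (upflow (surplus (target h.+1 c) c h [:: false])
   + upflow (surplus (target h.+1 c) c h [:: true])))%R.
  by rewrite /y /= nroot subr0.
(* A root with something to spare is added to the set. *)
have [y_gt0|y_le0] := ltrP 0%R y.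
  apply: (surplus_dominable (add_touched [::] _)).
    by rewrite /touched /= ?eqxx.
  rewrite /= -/c !eq_kid //; move: y_gt0; rewrite def_y.
  by move: (upflow _) (upflow _) => x0 x1; lia.
have gt_h' : 1 < h by case: (h) gt_n n0 => [|[]].
have kid_touched b : touched h.+1 (add_target h.+1 c [:: b]) [::].
  by rewrite /touched /=; case: b; rewrite ?orbT.
have kid_down b : surplus (add_target h.+1 c [:: b]) c h [:: b]
    = (surplus (target h.+1 c) c h [:: b] - 1)%R.
  have out_b : target h.+1 c [:: b] = false.
    rewrite (target_height c (add1n h : size [:: b] + h = h.+1)).
    by case: (h) gt_h' n0 => [|[|k]] // _ n0; apply/negP; lia.
  have := @surplus_root (target h.+1 c) (add_target h.+1 c [:: b]) c c h [:: b].
  rewrite out_b (_ : add_target _ _ _ _ = true); last first.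
    by rewrite /add_target /= eqxx.
  move=> root_b.
  suff: (forall v, suffix [:: b] v -> v != [:: b] ->
      target h.+1 c v = add_target h.+1 c [:: b] v /\ c v = c v).
    by move/root_b; move: (surplus _ _ _ _) (surplus _ _ _ _) => x0 x1 /=; lia.
  by move=> v _ nv; rewrite /add_target /= (negPf nv).
(* Otherwise a child is added whose contribution this does not change. *)
have [e1|n1] := eqVneq (upflow (surplus (target h.+1 c) c h [:: false] - 1)%R)
  (upflow (surplus (target h.+1 c) c h [:: false])).
  apply: (surplus_dominable (add_touched _ (kid_touched false))).
  rewrite /= -/c kid_down eq_kid // e1.
  by move: y_ge0; rewrite def_y /add_target /= [target _ _ _]nroot subr0.
have [e2|n2] := eqVneq (upflow (surplus (target h.+1 c) c h [:: true] - 1)%R)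
  (upflow (surplus (target h.+1 c) c h [:: true])).
  apply: (surplus_dominable (add_touched _ (kid_touched true))).
  rewrite /= -/c kid_down eq_kid // e2.
  by move: y_ge0; rewrite def_y /add_target /= [target _ _ _]nroot subr0.
have SBk b := target_stack_bound c gt_h' (add1n h : size [:: b] + h = h.+1).
have y0 : ((c [::])%:Z + (upflow (surplus (target h.+1 c) c h [:: false])
   + upflow (surplus (target h.+1 c) c h [:: true])) = 0)%R.
  by rewrite -def_y; apply: le_anti; rewrite y_le0.
have := stack_bound_root gt_h' (eqP n0) (SBk false) (SBk true)
  (elimN eqP n1) (elimN eqP n2) y0.
move: le_psi; rewrite /psi n0 P2 succnK -[c [::] + _]/(subtree_sum c h.+1 [::]).
by move: (subtree_sum _ _ _) (near_cost _) => p L; lia.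
Qed.

(** * Lower bound *)

Lemma potential_decr (G : graph) (phi : G -> nat -> nat) (C : config G) s :
    (forall u v a b, adj u v -> 2 <= a ->
       phi u (a - 2) + phi v b.+1 <= phi u a + phi v b) ->
    path (@pebbling_move G) C s ->
  \sum_v phi v (last C s v) <= \sum_v phi v (C v).
Proof.
move=> dec; elim: s C => //= C1 s IHs C /andP[/existsP[u /existsP[v]]].
case/and3P=> uv ge2 /eqP def_C1 /IHs/leq_trans; apply.
have neq_vu: v != u by apply: contraTneq uv => ->; rewrite adj_irrefl.
have split2 F :
    \sum_x F x = F u + F v + \sum_(x | (x != u) && (x != v)) F x :> nat.
  by rewrite (bigD1 u) //= (bigD1 v) //= addnA.
rewrite !split2.
apply: leq_add.
  rewrite def_C1 !ffunE eqxx (negPf neq_vu) eqxx addn1; exact: dec.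
apply: eq_leq; apply: eq_bigr => x /andP[nxu nxv].
by rewrite def_C1 ffunE (negPf nxu) (negPf nxv).
Qed.

Section LowerBound.
Variable n : nat.

(** The distance to the stack leaf, the word made of n letters false: it
decreases along the branch of that leaf and increases off this branch. *)
Fixpoint stack_dist (w : seq bool) :=
  if w is b :: u then
    if all negb w then (stack_dist u).-1 else (stack_dist u).+1
  else n.

(** The leaves that carry the scattered pebbles. *)
Definition free_leaf (w : seq bool) :=
  if w is b :: u then [&& size w == n, ~~ b & ~~ all negb u] else false.

Lemma stack_dist_far b (u : seq bool) : ~~ all negb u ->
  stack_dist (b :: u) = (stack_dist u).+1.
Proof. by move=> /= /negPf->; rewrite andbF. Qed.

Lemma stack_dist_near (w : seq bool) : all negb w -> stack_dist w = n - size w.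
Proof.
elim: w => [|b u IHu] /=; first by rewrite subn0.
by move=> aw; rewrite aw; case/andP: aw => _ /IHu->; lia.
Qed.

Lemma stack_dist_child b (u : seq bool) :
  2 ^ stack_dist u <= 2 * 2 ^ stack_dist (b :: u)
  /\ 2 ^ stack_dist (b :: u) <= 2 * 2 ^ stack_dist u.
Proof.
rewrite /= -!expnS; case: ifP => _; split; rewrite leq_exp2l //; lia.
Qed.

Definition paid (w : seq bool) k := (k - free_leaf w) * 2 ^ stack_dist w.

(** A move off a free leaf may take away only one pebble that is paid for, but
it goes to the parent, which is twice as cheap. *)
Lemma paid_decr (u v : complete_binary_tree n) a b : adj u v -> 2 <= a ->
  paid (val u) (a - 2) + paid (val v) b.+1 <= paid (val u) a + paid (val v) b.
Proof.
move=> /tree_adjP[d def_uv] ge2; rewrite /paid.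
have free_pos w : free_leaf w -> w = val u ->
    2 * 2 ^ stack_dist (val v) = 2 ^ stack_dist w.
  case: w => [|b' w] // /and3P[/eqP sz_w _ nw] def_u.
  have [def_v|[_ def_w]] : val v = d :: val u \/ b' :: w = d :: val v.
    - by rewrite def_u; case: def_uv; [left | right].
    - by have : size (val v) <= n := size_bseq v;
      rewrite def_v -def_u [size _]/= -[(size w).+1]/(size (b' :: w)) sz_w ltnn.
  by rewrite [val v](_ : _ = w) //= (negPf nw) andbF expnS.
have W1 : 2 ^ stack_dist (val v) <= 2 * 2 ^ stack_dist (val u).
  by case: def_uv => ->;
    [case: (stack_dist_child d (val u)) | case: (stack_dist_child d (val v))].
have := free_pos (val u); case: (free_leaf (val u)) => [/(_ isT erefl)|_];
  move: W1; move: (2 ^ _) (2 ^ _) => U V; case: (free_leaf _); nia.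
Qed.

Variable D : pred (seq bool).
Hypothesis domD : forall w, size w <= n -> touched n D w.

Definition cost (w : seq bool) := (D w && ~~ free_leaf w) * 2 ^ stack_dist w.

(** The two strict improvements feed each other: at height 1 mod 3, either the
root of the subtree is in D and is paid for, or both children are dominated from
within their subtrees, at height 0 mod 3; the latter requires an additional
vertex at the root of that subtree or at one of its children, at height
2 mod 3. *)
Lemma cost_far h (w : seq bool) : 0 < h -> size w + h = n -> ~~ all negb w ->
  [/\ 2 ^ stack_dist w * far_cost h <= subtree_sum cost h w,
    h %% 3 = 0 -> [|| D w, D (false :: w) | D (true :: w)] ->
      2 ^ stack_dist w * (far_cost h).+1 <= subtree_sum cost h w
  & h %% 3 = 2 -> D w ->
      2 ^ stack_dist w * (far_cost h).+1 <= subtree_sum cost h w].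
Proof.
elim: h w => // -[_|h IHh] w _ sz_w far_w.
  split=> //; rewrite [far_cost 1]/= [subtree_sum _ _ _]/= /cost
    (stack_dist_far false far_w) (stack_dist_far true far_w).
  have := domD (w := true :: w); rewrite /touched /= -sz_w addn1 ltnn.
  move=> /(_ (leqnn _)).
  rewrite (_ : free_leaf w = false); last first.
    by case: (w) sz_w => //= b u; case: eqP => // <-; lia.
  by rewrite !andbF expnS; case: (D w); case: (D (true :: w)); lia.
have dist_kid b := stack_dist_far b far_w.
have [||f1 f2 f3] := IHh (false :: w) isT; rewrite ?dist_kid.
- by move=> /=; lia.
- by [].
have [||t1 t2 t3] := IHh (true :: w) isT; rewrite ?dist_kid.
- by move=> /=; lia.
- by [].
move: f1 f2 f3 t1 t2 t3; rewrite !dist_kid !expnS.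
have tf := domD (w := false :: w) ltac:(by move=> /=; lia).
have tt := domD (w := true :: w) ltac:(by move=> /=; lia).
have cw : cost w = D w * 2 ^ stack_dist w.
  rewrite /cost (_ : free_leaf w = false) ?andbT //.
  by case: (w) sz_w => //= b u; case: eqP => // <-; lia.
rewrite [subtree_sum _ h.+2 _]subtree_sumS cw.
rewrite [far_cost h.+2]far_costS.
move: (subtree_sum cost h.+1 _) (subtree_sum cost h.+1 _) => s1 s2.
move: (far_cost h.+1) (2 ^ _) => M W.
have kid_dom b : D w = false -> touched n D (b :: w) ->
    [|| D (b :: w), D [:: false, b & w] | D [:: true, b & w]].
  by rewrite /touched => ->; case/or3P => [->||/andP[_ ->]] //; rewrite orbT.
have [h0|h1|h2] : [\/ h.+1 %% 3 = 0, h.+1 %% 3 = 1 | h.+1 %% 3 = 2].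
  by move: (ltn_pmod h.+1 (isT : 0 < 3)); case: (_ %% _) => [|[|[|]]] //;
    [constructor 1 | constructor 2 | constructor 3].
- have e : h.+2 %% 3 = 1 by lia.
  rewrite e => f1 f2 _ t1 t2 _; split=> //.
  case Dw: (D w); first by move: f1 t1; clear; lia.
  move: (f2 h0 (kid_dom false Dw tf)) (t2 h0 (kid_dom true Dw tt)).
  by clear; lia.
- have e : h.+2 %% 3 = 2 by lia.
  by rewrite e => f1 _ _ t1 _ _; split=> // [|_ ->]; lia.
have e : h.+2 %% 3 = 0 by lia.
rewrite e => f1 _ /(_ h2) f3 t1 _ /(_ h2) t3; split=> // [|_]; first by lia.
by case/or3P => [->|/f3|/t3]; lia.
Qed.

(** At height 1 mod 3 and for a root outside D, the domination of the child away
from the stack leaf already costs more than the root would. *)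
Lemma cost_near h (w : seq bool) : size w + h = n -> all negb w ->
  near_cost h <= subtree_sum cost h w /\
  (h %% 3 = 2 -> D w -> near_cost h + 2 ^ h <= subtree_sum cost h w).
Proof.
elim: h w => [|h IHh] w sz_w near_w; first by split.
have dist_w : stack_dist w = h.+1 by rewrite stack_dist_near //; lia.
have dist_t : stack_dist (true :: w) = h.+2 by rewrite /= dist_w.
have [||n1 n2] := IHh (false :: w) => //; first by move=> /=; lia.
have cw : cost w = D w * 2 ^ h.+1.
  rewrite /cost dist_w (_ : free_leaf w = false) ?andbT //.
  by case: (w) sz_w => //= b u; case: eqP => // <-; lia.
rewrite near_costS [subtree_sum _ h.+1 w]/= cw.
case: h sz_w {IHh cw} dist_w dist_t n1 n2 => [|h] sz_w dist_w dist_t n1 n2.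
  split=> //; move: n1; move: (subtree_sum cost 0 (false :: w)) => s0 _.
  have := domD (w := true :: w); rewrite /touched /= -sz_w addn1 ltnn.
  move=> /(_ (leqnn _)).
  rewrite /cost dist_t /= !andbF.
  by case: (D w); case: (D (true :: w)) => //; lia.
have far_t : ~~ all negb (true :: w) by [].
have sz_t : size (true :: w) + h.+1 = n by move=> /=; lia.
have [t1 t2 _] := cost_far (ltn0Sn h) sz_t far_t.
move: t1 t2 n1 n2; rewrite dist_t.
move: (subtree_sum cost h.+1 _) (subtree_sum cost h.+1 _) => s1 s2.
rewrite !expnS; move: (2 ^ h) (near_cost _) (far_cost _) => P N M t1 t2 n1 n2.
have [h0|h1] := eqVneq (h.+1 %% 3) 0.
  have e : h.+2 %% 3 = 1 by lia.
  rewrite e; split=> //; case Dw: (D w); first by lia.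
  have tt := domD (w := true :: w) ltac:(by move=> /=; lia).
  have /(t2 h0) :
      [|| D (true :: w), D [:: false, true & w] | D [:: true, true & w]].
    by move: tt; rewrite /touched Dw => /or3P[->||/andP[_ ->]] //; rewrite orbT.
  by lia.
have e : (h.+2 %% 3 == 1) = false by apply/negP; lia.
by rewrite e; split=> [|_ ->]; lia.
Qed.

(** When 3 divides n, the root is dominated by itself or by a child, and of
these the child on the branch of the stack leaf is the cheapest. *)
Lemma cost_root : 1 < n ->
  near_cost n + (if n %% 3 == 0 then 2 ^ n.-1 else 0) <=
  subtree_sum cost n [::].
Proof.
move=> gt_n; have [n1 _] := cost_near (add0n n : size [::] + n = n) isT.
case: eqP => [n0|_]; last by rewrite addn0.
have n_gt0 := ltnW gt_n; have n2 : n.-1 %% 3 = 2 by lia.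
have sz (b : bool) : size [:: b] + n.-1 = n by rewrite add1n prednK.
have gt_n1 : 0 < n.-1 by lia.
have [near1 /(_ n2) near2] := cost_near (sz false) isT.
have [far1 _ /(_ n2) far2] := cost_far gt_n1 (sz true) isT.
have dist_t : stack_dist [:: true] = n.+1 by [].
have := domD (w := [::]) isT; rewrite /touched n_gt0 /=.
have -> : subtree_sum cost n [::] = cost [::] +
    (subtree_sum cost n.-1 [:: false] + subtree_sum cost n.-1 [:: true]).
  by move: cost n_gt0 => F; case: (n).
have -> : near_cost n = near_cost n.-1 + 2 ^ n.+1 * far_cost n.-1.
  by rewrite -{1}(prednK n_gt0) near_costS prednK // n0 mul0n addn0.
have -> : cost [::] = D [::] * 2 ^ n by rewrite /cost /= andbT.
move: near1 near2 far1 far2; rewrite dist_t.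
rewrite (_ : 2 ^ n = 2 * 2 ^ n.-1); last first.
  by rewrite -expnS prednK.
rewrite (_ : 2 ^ n.+1 = 4 * 2 ^ n.-1); last first.
  by rewrite -{1}(prednK n_gt0) !expnS mulnA.
move: (subtree_sum _ _ _) (subtree_sum _ _ _) => s0 s1.
move: (near_cost _) (far_cost _) (2 ^ _) => N M P near1 near2 far1 far2.
case/or3P => [->|/near2|/far2]; move: near1 far1; clear; lia.
Qed.
End LowerBound.

(** Lets one configuration show that all smaller numbers of pebbles fail as
well, if it still fails after the removal of pebbles. *)
Lemma sub_config (G : graph) (F : config G) m : m <= num_pebbles F ->
  exists2 C : config G, forall v, C v <= F v & num_pebbles C = m.
Proof.
move def_k: (num_pebbles F - m) => k; elim: k F def_k => [|k IHk] F def_k le_m.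
  by exists F => //; apply/eqP; rewrite eqn_leq le_m -subn_eq0 def_k.
have /eqP/eqP : num_pebbles F != 0 by lia.
rewrite sum_nat_eq0 => /forallPn[/= v]; rewrite -lt0n => Fv_gt0.
pose F1 : config G := [ffun x => F x - (x == v)].
have def_F : num_pebbles F = (num_pebbles F1).+1.
  rewrite /num_pebbles (bigD1 v) //= [in RHS](bigD1 v) //= ffunE eqxx subn1.
  rewrite -addSn prednK //; congr (_ + _); apply: eq_bigr => x /negPf nx.
  by rewrite ffunE nx subn0.
have [||C le_C num_C] := IHk F1; try lia.
by exists C => // x; apply: leq_trans (le_C x) _; rewrite ffunE leq_subr.
Qed.

Lemma sum_free_far n h (w : seq bool) :
    0 < h -> size w + h = n -> ~~ all negb w ->
  subtree_sum (free_leaf n) h w = 2 ^ h.-1.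
Proof.
elim: h w => // -[_|h IHh] w _ sz_w far_w; have sz_lt : size w < n by lia.
  rewrite /= !andbF far_w -sz_w addn1 eqxx.
  by case: (w) sz_w => //= b u; case: eqP => //; lia.
have notin : free_leaf n w = false.
  by case: (w) sz_lt => //= b u; case: eqP => //; lia.
rewrite subtree_sumS notin add0n.
have [k0 k1] : ~~ all negb (false :: w) /\ ~~ all negb (true :: w) by [].
by rewrite !IHh //= ?addnn -?mul2n ?expnS //; lia.
Qed.

Lemma sum_free_near n h (w : seq bool) :
    0 < h -> size w + h = n -> all negb w ->
  (subtree_sum (free_leaf n) h w).+1 = 2 ^ h.-1.
Proof.
elim: h w => // -[_|h IHh] w _ sz_w near_w; have sz_lt : size w < n by lia.
  rewrite /= near_w !andbF.
  by case: (w) sz_lt => //= b u; case: eqP => //; lia.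
have notin : free_leaf n w = false.
  by case: (w) sz_lt => //= b u; case: eqP => //; lia.
rewrite subtree_sumS notin add0n -addSn IHh //; last by move=> /=; lia.
by rewrite (@sum_free_far n) //= ?addnn -?mul2n ?expnS //; lia.
Qed.

Section StackConfig.
Variables (n T : nat).
Hypothesis n_gt1 : 1 < n.
Local Notation G := (complete_binary_tree n).
Local Notation stack_leaf := (nseq n false).

Definition stack_config : config G :=
  [ffun v => (val v == stack_leaf) * T + free_leaf n (val v)].

Lemma num_stack_config : num_pebbles stack_config = T + (2 ^ n.-1 - 1).
Proof.
rewrite /num_pebbles; under eq_bigr => v _ do rewrite ffunE.
rewrite big_split /=; congr (_ + _).
  have le_l : size stack_leaf <= n by rewrite size_nseq.
  rewrite (bigD1 (vtx n stack_leaf)) //= val_vtx // eqxx mul1n.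
  by rewrite big1 ?addn0 // => v; rewrite -val_eqE /= val_vtx // => /negPf->.
rewrite (sum_words n (free_leaf n)).
by rewrite -(@sum_free_near n n [::]) ?subn1 // ltnW.
Qed.

Lemma stack_config_undominable (C : config G) :
    T < near_cost n + (if n %% 3 == 0 then 2 ^ n.-1 else 0) ->
  (forall v, C v <= stack_config v) -> ~ dominable C.
Proof.
move=> lt_T le_C [s [path_s /dominatingP dom]].
have := potential_decr (@paid_decr n) path_s; apply/negP; rewrite -ltnNge.
have [near_l sz_l] : all negb stack_leaf /\ size stack_leaf = n.
  by rewrite size_nseq all_nseq orbT.
have dist_l : stack_dist n stack_leaf = 0.
  by rewrite stack_dist_near // sz_l subnn.
have init : \sum_v paid n (val v) (C v) <= T.
  apply: leq_trans (_ : \sum_(v : n.-bseq bool) (val v == stack_leaf) * T <= T).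
    apply: leq_sum => v _; rewrite /paid.
    have := le_C v; rewrite ffunE.
    case: eqP => [->|_] le_Cv; last first.
      rewrite (_ : C v - free_leaf n (val v) = 0) //.
      by apply/eqP; rewrite subn_eq0.
    by rewrite dist_l muln1; lia.
  rewrite (bigD1 (vtx n stack_leaf)) //= val_vtx ?sz_l // eqxx mul1n.
  rewrite big1 ?addn0 // => v; rewrite -val_eqE /= val_vtx ?sz_l //.
  by move=> /negPf->.
apply: leq_ltn_trans init _; apply: leq_trans lt_T _.
apply: leq_trans (cost_root dom n_gt1) _; rewrite -sum_words.
apply: leq_sum => v _; rewrite /cost /paid leq_mul2r; apply/orP; right.
rewrite size_bseq vtxK inE.
by case: (free_leaf _ _); case: (last C s v).
Qed.
End StackConfig.

Lemma psi_minimal n m : 1 < n ->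
  always_dominable (complete_binary_tree n) m -> psi n <= m.
Proof.
move=> n_gt1 dom; rewrite leqNgt; apply/negP; rewrite /psi => lt_m.
(* The stack is one pebble short of the cost of a dominating set. *)
pose T := (near_cost n + (if n %% 3 == 0 then 2 ^ n.-1 else 0)).-1.
have cost_gt0 : 0 < near_cost n.
  case: (n) n_gt1 => // h _; elim: h => // h IHh.
  by rewrite near_costS -addnA ltn_addr.
have [|C le_C num_C] := @sub_config _ (stack_config n T) m.
  by rewrite num_stack_config // /T; move: lt_m; lia.
apply: (stack_config_undominable n_gt1 _ le_C (dom C num_C)).
by rewrite /T; lia.
Qed.

(** * Closed form *)

Definition far_term h i := 2 ^ (h - 1 - 3 * i) * 2 ^ (2 * h + 1 - 3 * i).

(** The index i stands for the vertices of height 3 i + 1, here in the half of a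
tree of height h + 1 that does not contain the stack leaf. *)
Lemma far_costE h :
  \sum_(0 <= i < (h + 2) %/ 3) far_term h i = 2 ^ h.+2 * far_cost h.
Proof.
elim: h => [|h IHh]; first by rewrite big_nil.
rewrite far_costS mulnDr mulnCA [_ * (_ * far_cost h)]mulnA [2 ^ h.+3]expnS.
rewrite -mulnA mulnCA -mulnA.
have step i : 0 <= i < (h + 2) %/ 3 -> far_term h.+1 i = 8 * far_term h i.
  move=> /andP[_ lt_i]; rewrite /far_term.
  have -> : h.+1 - 1 - 3 * i = (h - 1 - 3 * i).+1 by lia.
  have -> : 2 * h.+1 + 1 - 3 * i = (2 * h + 1 - 3 * i).+2 by lia.
  rewrite !expnS; lia.
have old : \sum_(0 <= i < (h + 2) %/ 3) far_term h.+1 i =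
    8 * (2 ^ h.+2 * far_cost h).
  by rewrite -IHh big_distrr; apply: eq_big_nat.
case: eqP => e.
  have -> : (h.+1 + 2) %/ 3 = ((h + 2) %/ 3).+1 by lia.
  rewrite big_nat_recr // old /far_term /=.
  have -> : h.+1 - 1 - 3 * ((h + 2) %/ 3) = 0 by lia.
  have -> : 2 * h.+1 + 1 - 3 * ((h + 2) %/ 3) = h.+3 by lia.
  rewrite !expnS; lia.
have -> : (h.+1 + 2) %/ 3 = (h + 2) %/ 3 by lia.
rewrite old !expnS; lia.
Qed.

Definition near_term n i := 2 ^ (3 * i + 1) +
  \sum_(1 <= j < (n - 3 * i - 2).+1) 2 ^ (j - 1) * 2 ^ (3 * i + 2 * j + 1).

(** When the tree grows by one level on top, the former tree becomes the half
that contains the stack leaf, so that the terms of [far_costE] for the other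
half of the former tree join the sum. *)
Lemma near_term_step h i : near_term h.+2 i =
  near_term h.+1 i + (if 3 * i < h then far_term h i else 0).
Proof.
rewrite /near_term -addnA; congr (_ + _); case: ltnP => [lt_i|ge_i].
  have -> : h.+2 - 3 * i - 2 = (h.+1 - 3 * i - 2).+1 by lia.
  rewrite big_nat_recr //=; congr (_ + _); rewrite /far_term.
  have -> : (h.+1 - 3 * i - 2).+1 - 1 = h - 1 - 3 * i by lia.
  by have -> : 3 * i + 2 * (h.+1 - 3 * i - 2).+1 + 1 = 2 * h + 1 - 3 * i by lia.
have -> : h.+2 - 3 * i - 2 = 0 by lia.
have -> : h.+1 - 3 * i - 2 = 0 by lia.
by rewrite addn0.
Qed.

(** The first sum of the formula collects the half of a tree of height h + 1
that contains the stack leaf, and the root. *)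
Lemma near_sumE h : \sum_(0 <= i < (h %/ 3).+1) near_term h.+1 i =
  near_cost h + (h.+1 %% 3 == 1) * 2 ^ h.+1.
Proof.
elim: h => [|h IHh]; first by rewrite big_nat1 /near_term big_geq.
rewrite near_costS [X in X + _]addnAC -IHh -far_costE.
have old : \sum_(0 <= i < (h %/ 3).+1) near_term h.+2 i =
    \sum_(0 <= i < (h %/ 3).+1) near_term h.+1 i +
    \sum_(0 <= i < (h + 2) %/ 3) far_term h i.
  under eq_bigr => i _ do rewrite near_term_step.
  rewrite big_split /=; congr (_ + _); case h0 : (h %% 3 == 0).
    rewrite big_nat_recr //= ifF ?addn0; last by lia.
    have -> : (h + 2) %/ 3 = h %/ 3 by lia.
    by apply: eq_big_nat => i /andP[_ lt_i]; rewrite ifT //; lia.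
  have -> : (h + 2) %/ 3 = (h %/ 3).+1 by lia.
  by apply: eq_big_nat => i /andP[_ lt_i]; rewrite ifT //; lia.
case: eqP => e.
  have -> : h.+1 %/ 3 = (h %/ 3).+1 by lia.
  rewrite big_nat_recr //= old mul1n; congr (_ + _).
  rewrite /near_term big_geq ?addn0; last by lia.
  by congr (2 ^ _); lia.
have -> : h.+1 %/ 3 = h %/ 3 by lia.
by rewrite old mul0n addn0.
Qed.

Lemma psiE n : 1 < n ->
  (2 ^ (n - 1) - 1)
     + \sum_(0 <= i < ((n - 1) %/ 3).+1)
         (2 ^ (3 * i + 1)
          + \sum_(1 <= j < (n - 3 * i - 2).+1)
              2 ^ (j - 1) * 2 ^ (3 * i + 2 * j + 1))
     + \sum_(1 <= k < ((n + 1) %/ 3).+1)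
         2 ^ (n + 1 - 3 * k) * 2 ^ (2 * n + 2 - 3 * k)
     + (if n == 0 %[mod 3] then 2 ^ (n - 1) else 0) = psi n.
Proof.
case: n => // h _; rewrite /psi succnK.
rewrite (_ : h.+1 - 1 = h); last by rewrite subn1.
congr (_ + _); rewrite -addnA; congr (_ + _).
have := near_sumE h; rewrite /near_term => ->.
rewrite near_costS -[RHS]addnA addnAC -!addnA; congr (_ + (_ + _)).
rewrite big_add1 succnK -far_costE (_ : h.+1 + 1 = h + 2); last by lia.
apply: eq_big_nat => i _; rewrite /far_term.
by congr (2 ^ _ * 2 ^ _); lia.
Qed.

Theorem theorem8 (n : nat) (hn : 2 <= n) :
  domination_cover_pebbling_number (complete_binary_tree n)
    ((2 ^ (n - 1) - 1)
     + \sum_(0 <= i < ((n - 1) %/ 3).+1)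
         (2 ^ (3 * i + 1)
          + \sum_(1 <= j < (n - 3 * i - 2).+1)
              2 ^ (j - 1) * 2 ^ (3 * i + 2 * j + 1))
     + \sum_(1 <= k < ((n + 1) %/ 3).+1)
         2 ^ (n + 1 - 3 * k) * 2 ^ (2 * n + 2 - 3 * k)
     + (if n == 0 %[mod 3] then 2 ^ (n - 1) else 0)).
Proof.
rewrite psiE //; split=> [C num_C|m]; last exact: psi_minimal.
by apply: psi_dominable; rewrite ?num_C.
Qed.
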